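(* Let $p$ be an odd prime and $m$, $r$ two positive integers with $p\nmid m$. Then $$P_{p-1,m,r}(q,x) \equiv (-1)^{\langle -\frac{r}{m}\rangle_p} P_{p-1,m,r}(q,-x) \pmod{[p]}.$$
   Context: $q$ and $x$ are indeterminates. $(a;q)_0=1$ and $(a;q)_n=(1-a)(1-aq)\cdots(1-aq^{n-1})$ for $n\ge 1$; so $(a;q^m)_n=\prod_{j=0}^{n-1}(1-aq^{mj})$. Define $$P_{n,m,r}(q,x)=\sum_{k=0}^{n}\frac{(q^r;q^m)_k (q^{m-r};q^m)_k (x;q^m)_k q^{mk}}{(q^m;q^m)_k^2 (-q^m;q^m)_k}.$$ For a $p$-adic integer $a$ (e.g. $a=-r/m$ with $p\nmid m$), $\langle a\rangle_p$ denotes the least nonnegative residue of $a$ modulo $p$. $[p]=1+q+\cdots+q^{p-1}$, which is irreducible in $\mathbb{Q}[q]$ for $p$ prime. For rational functions $A(q),B(q)\in\mathbb{Q}(q)$ whose denominators are relatively prime to $[p]$, $A\equiv B\pmod{[p]}$ means that $A-B$ can be written as a fraction whose numerator is divisible by $[p]$ in $\mathbb{Q}[q]$ and whose denominator is relatively prime to $[p]$ (negative powers of $q$ are allowed). For polynomials in $x$ with such coefficients, congruence modulo $[p]$ means congruence of the coefficients of $x^k$ modulo $[p]$ for every $k$. *)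

(* Defs.v *)
From HB Require Import structures.
From mathcomp Require Import all_boot all_order all_algebra.

Set Implicit Arguments.
Unset Strict Implicit.
Unset Printing Implicit Defensive.

Import Order.TTheory GRing.Theory Num.Theory.
Local Open Scope ring_scope.

(* The field Q(q) of rational functions in q. *)
Notation Qq := {fraction {poly rat}}.

Definition qq : Qq := tofrac 'X.

Definition qpoch (R : comNzRingType) (a b : R) (n : nat) : R :=
  \prod_(j < n) (1 - a * b ^+ j).

(* The exponent [m - r] is an integer, possibly negative.  [P n m r x] is
   applied to ['X] for P(q, x) and to [- 'X] for P(q, -x); both are polynomials
   in x with coefficients in Q(q). *)
Definition P (n m r : nat) (x : {poly Qq}) : {poly Qq} :=
  \sum_(k < n.+1)
    (qpoch (qq ^+ r) (qq ^+ m) k * qpoch (qq ^ (m%:Z - r%:Z)) (qq ^+ m) k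
       * qq ^+ (m * k)
     / (qpoch (qq ^+ m) (qq ^+ m) k ^+ 2 * qpoch (- qq ^+ m) (qq ^+ m) k))
    *: qpoch x (qq ^+ m)%:P k.

Definition qint (p : nat) : {poly rat} := \sum_(i < p) 'X^i.

Definition den_coprime (p : nat) (A : Qq) : Prop :=
  exists N D : {poly rat}, coprimep D (qint p) /\ A = tofrac N / tofrac D.

(* The relation is only defined between rational functions with denominators
   coprime to [p], hence the first two conjuncts. *)
Definition congr_qint (p : nat) (A B : Qq) : Prop :=
  [/\ den_coprime p A, den_coprime p B &
      exists N D : {poly rat},
        [/\ qint p %| N, coprimep D (qint p) & A - B = tofrac N / tofrac D]].

Definition congr_qint_poly (p : nat) (A B : {poly Qq}) : Prop :=
  forall k : nat, congr_qint p A`_k B`_k.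

(* For p prime not dividing the denominator of a, [ratr a] is the class of
   numq a / denq a in F_p, whose underlying natural number is its
   representative in {0, ..., p - 1}. *)
Definition least_residue (p : nat) (a : rat) : nat := (ratr a : 'F_p).

(* Main.v *)
Require Import Defs.
From HB Require Import structures.
From mathcomp Require Import all_boot all_order all_algebra.
From mathcomp Require Import all_field ring.

Set Implicit Arguments.
Unset Strict Implicit.
Unset Printing Implicit Defensive.

Import Order.TTheory GRing.Theory Num.Theory.
Local Open Scope ring_scope.

(** Reducing modulo [qint p] amounts to putting q = z for a primitive p-th root
    of unity z, as [qint p] is the minimal polynomial of z over the rationals.
    Let a be the least residue of -r/m modulo p and w = z^m, again a primitive
    p-th root of unity.  Then z^r = w^(-a) and z^(m-r) = w^(a+1), so P becomes

      y(x) = \sum_(k < p) (w^-a)_k (w^(a+1))_k (x)_k w^k / ((w)_k^2 (-w)_k),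

    a big q-Legendre polynomial for the interval that is symmetric around 0,
    and the claim is that y has the parity of a.

    For generic w the polynomial y is an eigenvector of a second order
    q-difference operator that commutes with x |-> -x.  Read on the
    coefficients of y, with u = w^-a and v = w^(a+1), so that u v = w, the
    eigenvalue equation is a recurrence with step two:

      (1 - u w^n) (1 - v w^n) y_n = (1 - w^(n+1)) (1 - w^(n+2)) y_(n+2).

    It holds for each partial sum of the series up to a boundary term
    ([recur_qlegendre]), and that term carries the factor (w^-a)_p = 0.  Now
    let n < p have the parity opposite to that of a.  The factor on the left
    vanishes only if n = a or n + a + 1 = p, and for p odd both force n and a to
    have the same parity.  So y_n is a multiple of y_(n+2), and going down from
    the coefficients of index at least p, which are 0, all such y_n vanish
    ([coef_qlegendre_prim]).

    The passage from Q(q) to the complex numbers is made through the relation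
    [specializes z A c]: A is a quotient N / D with D(z) <> 0 and value c
    at z.  It is compatible with the field operations, and two rational
    functions with the same value at z are congruent modulo [qint p]
    ([congr_of_specializes]). *)

(** * Coefficients of the polynomials (x; w)_k *)

Lemma qpochS (R : comNzRingType) (a b : R) n :
  qpoch a b n.+1 = qpoch a b n * (1 - a * b ^+ n).
Proof. by rewrite /qpoch big_ord_recr. Qed.

Section QPochCoef.
Variables (R : comNzRingType) (w : R).
Implicit Types k n : nat.

Lemma coef0_qpochX k : (qpoch 'X w%:P k)`_0 = 1.
Proof.
elim: k => [|k IH]; first by rewrite /qpoch big_ord0 coef1.
by rewrite qpochS mulrBr mulr1 coefB IH -polyC_exp mulrA coefMC coefMX /= mul0r subr0.
Qed.

Lemma coefS_qpochX k n :
  (qpoch 'X w%:P k.+1)`_n.+1 =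
  (qpoch 'X w%:P k)`_n.+1 - w ^+ k * (qpoch 'X w%:P k)`_n.
Proof.
by rewrite qpochS mulrBr mulr1 coefB -polyC_exp mulrA coefMC coefMX /= [_ * w ^+ k]mulrC.
Qed.

(** Both sides are coefficients in (1 - x) (w x; w)_k = (1 - x w^k) (x; w)_k. *)
Lemma coef_qpochX_step k n :
  (1 - w ^+ n.+1) * (qpoch 'X w%:P k)`_n.+1 =
  (w ^+ k - w ^+ n) * (qpoch 'X w%:P k)`_n.
Proof.
elim: k n => [|k IH] n.
  rewrite /qpoch big_ord0 !coef1; case: n => [|n] /=.
    by rewrite !expr0 subrr mulr0 mul0r.
  by rewrite !mulr0.
case: n => [|n].
  have := IH 0; rewrite coefS_qpochX !coef0_qpochX !expr1 !expr0 => IH0.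
  rewrite mulrBr IH0 exprS; ring.
rewrite !coefS_qpochX mulrBr IH.
have := IH n; set x := _`_n.+1; set y := _`_n => IHn.
have -> : (w ^+ k.+1 - w ^+ n.+1) * (x - w ^+ k * y) =
  (w ^+ k.+1 - w ^+ n.+1) * x - w ^+ k.+1 * ((w ^+ k - w ^+ n) * y).
  by rewrite !exprS; ring.
rewrite -IHn !exprS; ring.
Qed.

(** This is the ratio of the q-binomial coefficients [k choose n] and
    [k+1 choose n], which are the coefficients up to the same sign and power
    of w; the form chosen avoids division. *)
Lemma coef_qpochX_lower k n :
  (1 - w ^+ k.+1) * w ^+ n * (qpoch 'X w%:P k)`_n =
  (w ^+ n - w ^+ k.+1) * (qpoch 'X w%:P k.+1)`_n.
Proof.
case: n => [|n]; first by rewrite !coef0_qpochX expr0; ring.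
rewrite coefS_qpochX.
have := coef_qpochX_step k n; set x := _`_n.+1; set y := _`_n => e.
have -> : (w ^+ n.+1 - w ^+ k.+1) * (x - w ^+ k * y) =
  (w ^+ n.+1 - w ^+ k.+1) * x + w ^+ k.+1 * ((w ^+ k - w ^+ n) * y).
  by rewrite !exprS; ring.
rewrite -e !exprS; ring.
Qed.

(** The defect of [f] in the recurrence, that is, up to the factor w^n, the
    coefficient of x^n in (L - lambda) f for the q-difference operator L
    of the big q-Legendre polynomials.  Keeping the parameters u and v
    instead of the eigenvalue avoids negative powers of w. *)
Definition recur_defect (u v : R) (f : {poly R}) n :=
  (1 - u * w ^+ n) * (1 - v * w ^+ n) * f`_n
  - (1 - w ^+ n.+1) * (1 - w ^+ n.+2) * f`_n.+2.

Lemma recur_qpochX0 u v n : u * v = w ->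
  recur_defect u v (qpoch 'X w%:P 0) n
  = w ^+ n * ((1 - u) * (1 - v) * (qpoch 'X w%:P 0)`_n).
Proof.
rewrite /recur_defect /qpoch big_ord0 !coef1; case: n => [|n] _ /=.
  by rewrite expr0; ring.
by rewrite !mulr0 subrr.
Qed.

(** The basis (x; w)_k makes the operator bidiagonal.  All the coefficients
    involved are multiples of the n-th coefficient of (x; w)_(k+1), by
    [coef_qpochX_step] used twice and [coef_qpochX_lower], and there remains a
    polynomial identity that uses u v = w. *)
Lemma recur_qpochXS u v k n : u * v = w ->
  w ^+ k.+1 * recur_defect u v (qpoch 'X w%:P k.+1) n
  = w ^+ n * ((1 - u * w ^+ k.+1) * (1 - v * w ^+ k.+1) * (qpoch 'X w%:P k.+1)`_n
      - (1 - w ^+ k.+1) ^+ 2 * (1 + w ^+ k.+1) * (qpoch 'X w%:P k)`_n).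
Proof.
move=> uv; rewrite /recur_defect.
have e1 := coef_qpochX_step k.+1 n.
have e2 := coef_qpochX_step k.+1 n.+1.
have e3 := coef_qpochX_lower k n.
set x := _`_n in e1 e3 *; set x1 := _`_n.+1 in e1 e2 *.
set x2 := _`_n.+2 in e2 *; set y := _`_n in e3 *.
have -> : (1 - w ^+ n.+1) * (1 - w ^+ n.+2) * x2
  = (w ^+ k.+1 - w ^+ n.+1) * ((w ^+ k.+1 - w ^+ n) * x).
  by rewrite -mulrA e2 mulrCA e1.
rewrite [RHS]mulrBr.
have -> : w ^+ n * ((1 - w ^+ k.+1) ^+ 2 * (1 + w ^+ k.+1) * y) =
  (1 - w ^+ k.+1) * (1 + w ^+ k.+1) * ((w ^+ n - w ^+ k.+1) * x).
  by rewrite -e3; ring.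
rewrite [w ^+ n.+1]exprS; move: (w ^+ k.+1) (w ^+ n) => A B; rewrite -uv; ring.
Qed.

Lemma coef_qpochX_gt k n : (k < n)%N -> (qpoch 'X w%:P k)`_n = 0.
Proof.
elim: k n => [|k IH] [|n] //= lt_kn; first by rewrite /qpoch big_ord0 coef1.
by rewrite coefS_qpochX !IH ?mulr0 ?subrr // ltnW.
Qed.
End QPochCoef.

(** * The coefficient recurrence for the truncated series *)

Section QLegendre.
Variables (K : fieldType) (w : K).

Definition qlegendre_coef (u v : K) k :=
  qpoch u w k * qpoch v w k * w ^+ k / (qpoch w w k ^+ 2 * qpoch (- w) w k).

Definition qlegendre (u v : K) N (x : {poly K}) :=
  \sum_(k < N) qlegendre_coef u v k *: qpoch x w%:P k.

Lemma recurD u v (f g : {poly K}) n :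
  recur_defect w u v (f + g) n = recur_defect w u v f n + recur_defect w u v g n.
Proof. rewrite /recur_defect !coefD; ring. Qed.

Lemma recurZ u v c (f : {poly K}) n :
  recur_defect w u v (c *: f) n = c * recur_defect w u v f n.
Proof. rewrite /recur_defect !coefZ; ring. Qed.

(** The ratio of consecutive coefficients of the series is the one for which the
    contributions from [recur_qpochXS] telescope; only the upper boundary
    remains. *)
Lemma recur_qlegendre u v N n : u * v = w ->
    (forall k, (0 < k <= N)%N -> (1 - w ^+ k) * (1 + w ^+ k) != 0) ->
  recur_defect w u v (qlegendre u v N.+1 'X) n =
  w ^+ n * (qpoch u w N.+1 * qpoch v w N.+1
            / (qpoch w w N ^+ 2 * qpoch (- w) w N) * (qpoch 'X w%:P N)`_n).
Proof.
move=> uv; elim: N => [|N IH] nz.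
  rewrite /qlegendre big_ord1 recurZ recur_qpochX0 // /qlegendre_coef !qpochS.
  have q0 (a : K) : qpoch a w 0 = 1 by rewrite /qpoch big_ord0.
  by rewrite !q0 !(expr0, expr1n, mul1r, mulr1, invr1).
rewrite /qlegendre big_ord_recr /= -/(qlegendre u v N.+1 'X) recurD recurZ IH; last first.
  by move=> k /andP[k0 kN]; apply: nz; rewrite k0 leqW.
rewrite {1}/qlegendre_coef [_ * w ^+ _ / _]mulrAC -[X in _ + X]mulrA recur_qpochXS //.
have := nz N.+1; rewrite ltnS leqnn => /(_ isT).
rewrite mulf_eq0 negb_or => /andP[n1 n2].
have e1 : qpoch w w N.+1 = qpoch w w N * (1 - w ^+ N.+1) by rewrite qpochS -exprS.
have e2 : qpoch (- w) w N.+1 = qpoch (- w) w N * (1 + w ^+ N.+1).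
  by rewrite qpochS mulNr opprK -exprS.
rewrite ![qpoch u w N.+2]qpochS ![qpoch v w N.+2]qpochS e1 e2 !expr2 !invfM.
have := mulVf n1; have := mulVf n2.
move: (1 - w ^+ N.+1) (1 + w ^+ N.+1) (qpoch u w _) (qpoch v w _) => A B U V.
move: (A^-1) (B^-1) => A' B' eB eA.
move: (qpoch w w N)^-1 (qpoch (- w) w N)^-1 (w ^+ n) => P Q s.
move: (u * _) (v * _) _`_n _`_n => a b x y.
(* The old boundary term cancels against the lower term of [recur_qpochXS]. *)
have -> : s * (U * V * (P * P * Q) * y)
    = s * (U * V * (P * P * Q) * y) * ((A' * A) * (A' * A) * (B' * B)).
  by rewrite eA eB !mulr1.
ring.
Qed.

(** * Parity at a root of unity *)

Lemma coef_qpoch_oppX k n :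
  (qpoch (- 'X) w%:P k)`_n = (-1) ^+ n * (qpoch 'X w%:P k)`_n.
Proof.
elim: k n => [|k IH] n.
  by rewrite /qpoch !big_ord0 !coef1; case: n => [|n]; rewrite ?expr0 ?mul1r ?mulr0.
rewrite !qpochS !mulrBr !mulr1 !coefB -!polyC_exp !mulrA !coefMC mulrN coefN !coefMX !IH.
by case: n => [|n] /=; rewrite ?expr0 ?exprS; ring.
Qed.

Lemma coef_qlegendre_oppX u v N n :
  (qlegendre u v N (- 'X))`_n = (-1) ^+ n * (qlegendre u v N 'X)`_n.
Proof.
rewrite /qlegendre !coef_sum mulr_sumr; apply: eq_bigr => k _.
by rewrite !coefZ coef_qpoch_oppX mulrCA.
Qed.

Lemma coef_qlegendre_ge u v N n : (N <= n)%N -> (qlegendre u v N 'X)`_n = 0.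
Proof.
move=> leNn; rewrite /qlegendre coef_sum big1 // => k _.
by rewrite coefZ coef_qpochX_gt ?mulr0 // (leq_trans (ltn_ord k)).
Qed.

Section RootOfUnity.
Variables (p a : nat) (u : K).
Hypotheses (p_odd : odd p) (w_prim : p.-primitive_root w) (lt_ap : (a < p)%N).
Hypothesis (one_neqN1 : 1 != -1 :> K).
Hypothesis (u_def : u * w ^+ a = 1).

(** If w^k were -1, raising to the odd power p would give 1 = -1. *)
Lemma prim_den_neq0 k : (0 < k < p)%N -> (1 - w ^+ k) * (1 + w ^+ k) != 0.
Proof.
case/andP=> k0 kp; rewrite mulf_neq0 //.
  by rewrite subr_eq0 eq_sym -(prim_order_dvd w_prim) gtnNdvd.
rewrite addrC addr_eq0; apply/negP => /eqP wk.
have := congr1 (fun x => x ^+ p) wk; rewrite exprAC (prim_expr_order w_prim) expr1n.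
by rewrite -signr_odd p_odd expr1 => /eqP; rewrite (negPf one_neqN1).
Qed.

(** The first factor vanishes only for n = a, the second only for
    n + a + 1 = p, because 0 < n + a + 1 < 2 p; p being odd, n and a have the
    same parity in both cases. *)
Lemma prim_factor_neq0 n : (n < p)%N -> odd n != odd a ->
  (1 - u * w ^+ n) * (1 - w ^+ a.+1 * w ^+ n) != 0.
Proof.
move=> ltnp par; rewrite mulf_neq0 // subr_eq0 eq_sym.
  apply/negP => /eqP un; have : w ^+ n == w ^+ a.
    by rewrite -[w ^+ n]mul1r -u_def mulrAC un mul1r.
  rewrite (eq_prim_root_expr w_prim) !modn_small // => /eqP e.
  by rewrite e eqxx in par.
rewrite -exprD -(prim_order_dvd w_prim); apply/negP => /dvdnP[[|[|c]]] //.
  rewrite mul1n => e; move: p_odd par; rewrite -e oddD /=.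
  by case: (odd a); case: (odd n).
apply/eqP; rewrite neq_ltn; apply/orP; left.
apply: (@leq_trans (2 * p)); last by rewrite leq_mul2r orbT.
by rewrite mul2n -addnn -addnS leq_add.
Qed.

(** The boundary term of [recur_qlegendre] is 0 because (u; w)_p contains
    the factor 1 - u w^a.  Hence the recurrence is exact, and it is used
    downwards from the indices beyond the degree. *)
Lemma coef_qlegendre_prim n : odd n != odd a ->
  (qlegendre u (w ^+ a.+1) p 'X)`_n = 0.
Proof.
have p0 : (0 < p)%N by case: p p_odd.
have uv : u * w ^+ a.+1 = w by rewrite exprS mulrCA u_def mulr1.
have rec k : recur_defect w u (w ^+ a.+1) (qlegendre u (w ^+ a.+1) p 'X) k = 0.
  rewrite -(prednK p0) recur_qlegendre //; last first.
    move=> j /andP[j0 jp]; apply: prim_den_neq0.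
    by rewrite j0 -(prednK p0) ltnS.
  rewrite prednK // [qpoch u w p](_ : _ = 0) ?(mul0r, mulr0) //.
  rewrite /qpoch; apply/eqP/prodf_eq0; exists (Ordinal lt_ap) => //=.
  by rewrite u_def subrr.
have [d] := ubnP (p - n); elim: d n => // d IH n; rewrite ltnS => led par.
have [lenp|ltnp] := leqP p n; first exact: coef_qlegendre_ge.
have := rec n; rewrite /recur_defect [X in _ - _ * X]IH /=; first last.
- by rewrite negbK.
- rewrite (leq_trans _ led) //; apply: ltn_sub2l => //; exact: leqnSn.
rewrite mulr0 subr0 => /eqP; rewrite mulf_eq0 (negPf (prim_factor_neq0 _ _)) //.
by move/eqP.
Qed.

Lemma qlegendre_prim_parity :
  qlegendre u (w ^+ a.+1) p 'X = (-1) ^+ a *: qlegendre u (w ^+ a.+1) p (- 'X).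
Proof.
apply/polyP => n; rewrite coefZ coef_qlegendre_oppX mulrA -exprD -signr_odd oddD.
have [->|par] := eqVneq (odd n) (odd a); first by rewrite addbb mul1r.
by rewrite coef_qlegendre_prim ?mulr0.
Qed.
End RootOfUnity.
End QLegendre.

(** * Evaluation of rational functions at a complex number *)

Section Specialization.
Variable z : algC.

Definition ev (f : {poly rat}) : algC := (map_poly ratr f).[z].

(** A relation rather than a function, as evaluation at z is only partial on
    Q(q). *)
Definition specializes (A : Qq) (a : algC) :=
  exists N D : {poly rat},
    [/\ ev D != 0, A = tofrac N / tofrac D & a = ev N / ev D].

Definition specializes_poly (f : {poly Qq}) (g : {poly algC}) :=
  forall k, specializes f`_k g`_k.

Lemma evD f g : ev (f + g) = ev f + ev g.
Proof. by rewrite /ev rmorphD hornerD. Qed.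
Lemma evM f g : ev (f * g) = ev f * ev g.
Proof. by rewrite /ev rmorphM hornerM. Qed.
Lemma evN f : ev (- f) = - ev f.
Proof. by rewrite /ev rmorphN hornerN. Qed.
Lemma ev0 : ev 0 = 0.
Proof. by rewrite /ev map_poly0 horner0. Qed.
Lemma ev1 : ev 1 = 1.
Proof. by rewrite /ev rmorph1 hornerC. Qed.
Lemma evX : ev 'X = z.
Proof. by rewrite /ev map_polyX hornerX. Qed.

Lemma tofrac_neq0 D : ev D != 0 -> tofrac D != 0.
Proof.
by apply: contra_neq => /eqP; rewrite tofrac_eq0 => /eqP->; apply: ev0.
Qed.

Lemma specializes_tofrac f : specializes (tofrac f) (ev f).
Proof. by exists f, 1; rewrite ev1 oner_neq0 tofrac1 !divr1. Qed.

Lemma specializes1 : specializes 1 1.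
Proof. by have := specializes_tofrac 1; rewrite ev1 tofrac1. Qed.

Lemma specializes0 : specializes 0 0.
Proof. by have := specializes_tofrac 0; rewrite ev0 tofrac0. Qed.

Lemma specializesD A B a b :
  specializes A a -> specializes B b -> specializes (A + B) (a + b).
Proof.
move=> [N [D [nzD -> ->]]] [M [E [nzE -> ->]]]; exists (N * E + M * D), (D * E).
rewrite !evD !evM mulf_neq0 // tofracD !tofracM.
by rewrite !addf_div // tofrac_neq0.
Qed.

Lemma specializesM A B a b :
  specializes A a -> specializes B b -> specializes (A * B) (a * b).
Proof.
move=> [N [D [nzD -> ->]]] [M [E [nzE -> ->]]]; exists (N * M), (D * E).
by rewrite !evM mulf_neq0 // !tofracM !mulf_div.
Qed.

Lemma specializesN A a : specializes A a -> specializes (- A) (- a).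
Proof.
by move=> [N [D [nzD -> ->]]]; exists (- N), D; rewrite evN tofracN !mulNr.
Qed.

Lemma specializesV A a : a != 0 -> specializes A a -> specializes A^-1 a^-1.
Proof.
move=> nza [N [D [nzD -> e]]]; exists D, N; split; last by rewrite e invf_div.
  by apply: contra_neq nza => eN; rewrite e eN mul0r.
by rewrite invf_div.
Qed.

Lemma specializesX A a n : specializes A a -> specializes (A ^+ n) (a ^+ n).
Proof.
move=> sA; elim: n => [|n IH]; first exact: specializes1.
by rewrite !exprS; apply: specializesM.
Qed.

Lemma specializesXz A a (n : int) :
  a != 0 -> specializes A a -> specializes (A ^ n) (a ^ n).
Proof.
move=> nza sA; case: n => n; first exact: specializesX.
by apply: specializesV (specializesX _ sA); rewrite expf_neq0.
Qed.

Lemma specializes_sum (I : Type) (s : seq I) (F : I -> Qq) (G : I -> algC) :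
    (forall i, specializes (F i) (G i)) ->
  specializes (\sum_(i <- s) F i) (\sum_(i <- s) G i).
Proof.
move=> FG; elim/big_rec2: _ => [|i y1 y2 _ IH]; first exact: specializes0.
exact: specializesD.
Qed.

Lemma specializes_qpoch A B a b n : specializes A a -> specializes B b ->
  specializes (qpoch A B n) (qpoch a b n).
Proof.
move=> sA sB; rewrite /qpoch; elim/big_rec2: _ => [|i y1 y2 _ IH].
  exact: specializes1.
apply: specializesM IH; apply: specializesD specializes1 _.
by apply/specializesN/specializesM => //; apply: specializesX.
Qed.

Lemma specializes_polyD f g f' g' : specializes_poly f f' ->
  specializes_poly g g' -> specializes_poly (f + g) (f' + g').
Proof. by move=> sf sg k; rewrite !coefD; apply: specializesD. Qed.

Lemma specializes_polyN f f' :
  specializes_poly f f' -> specializes_poly (- f) (- f').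
Proof. by move=> sf k; rewrite !coefN; apply: specializesN. Qed.

Lemma specializes_polyZ A a f f' : specializes A a ->
  specializes_poly f f' -> specializes_poly (A *: f) (a *: f').
Proof. by move=> sA sf k; rewrite !coefZ; apply: specializesM. Qed.

Lemma specializes_polyM f g f' g' : specializes_poly f f' ->
  specializes_poly g g' -> specializes_poly (f * g) (f' * g').
Proof.
move=> sf sg k; rewrite !coefM; apply: specializes_sum => i.
exact: specializesM.
Qed.

Lemma specializes_polyC A a : specializes A a -> specializes_poly A%:P a%:P.
Proof. by move=> sA k; rewrite !coefC; case: eqP => // _; apply: specializes0. Qed.

Lemma specializes_polyX : specializes_poly 'X 'X.
Proof.
by move=> k; rewrite !coefX; case: eqP => _; [exact: specializes1|exact: specializes0].
Qed.

(** The denominators of the series have nonzero value, so they may be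
    inverted in the relation. *)
Lemma specializes_poly_qlegendre W w U u V v N X x :
    (forall k, (0 < k < N)%N -> (1 - w ^+ k) * (1 + w ^+ k) != 0) ->
    specializes W w -> specializes U u -> specializes V v ->
    specializes_poly X x ->
  specializes_poly (qlegendre W U V N X) (qlegendre w u v N x).
Proof.
move=> nz sW sU sV sX; rewrite /qlegendre.
elim/big_rec2: _ => [|[k /= ltkN] y1 y2 _ IH].
  by move=> k; rewrite !coef0; apply: specializes0.
apply: specializes_polyD IH; apply: specializes_polyZ; last first.
  rewrite /qpoch; elim/big_rec2: _ => [|i x1 x2 _ IH].
    exact/specializes_polyC/specializes1.
  apply: specializes_polyM IH; apply: specializes_polyD.
    exact/specializes_polyC/specializes1.
  apply/specializes_polyN/specializes_polyM => //.
  by rewrite -!polyC_exp; apply/specializes_polyC/specializesX.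
have nz1 (b : algC) : (forall j, (j < k)%N -> 1 - b * w ^+ j != 0) ->
  qpoch b w k != 0.
  by move=> h; apply/prodf_neq0 => [[j jk]] _; apply: h.
have nzj j : (j < k)%N -> (1 - w ^+ j.+1) * (1 + w ^+ j.+1) != 0.
  by move=> jk; apply: nz; rewrite /= (leq_ltn_trans jk).
apply: specializesM.
  apply: specializesM (specializesX _ sW).
  by apply: specializesM; apply: specializes_qpoch.
apply: specializesV.
  rewrite mulf_neq0 ?expf_neq0 //; apply: nz1 => j /nzj.
    by rewrite mulf_eq0 negb_or -exprS => /andP[].
  by rewrite mulf_eq0 negb_or mulNr opprK -exprS => /andP[].
apply: specializesM; last by apply: specializes_qpoch => //; apply: specializesN.
exact/specializesX/specializes_qpoch.
Qed.

Lemma size_qint p : size (qint p) = p.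
Proof.
have -> : qint p = \poly_(i < p) 1.
  by rewrite poly_def; apply: eq_bigr => i _; rewrite scale1r.
by rewrite size_poly_eq ?oner_neq0.
Qed.

Section PrimeOrder.
Variable p : nat.
Hypotheses (p_prime : prime p) (z_prim : p.-primitive_root z).

(** The minimal polynomial of z is the p-th cyclotomic polynomial.  It divides
    [qint p], as z is a root of X^p - 1 = (X - 1) [qint p] other than 1, and it has
    the same degree. *)
Lemma ev_qint_eq0 f : (ev f == 0) = (qint p %| f).
Proof.
have [g [eg _ root_g]] := minCpolyP z.
have e h : (ev h == 0) = (g %| h) by rewrite -root_g.
rewrite e; apply: eqp_dvdl.
have szg : size g = p.
  rewrite -(size_map_poly (ratr : {rmorphism rat -> algC})) -eg.
  rewrite (minCpoly_cyclotomic z_prim) size_cyclotomic totient_prime //.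
  by rewrite prednK ?prime_gt0.
have szq := size_qint p.
have g_dvd : g %| qint p.
  rewrite -e; have : ev ('X - 1) * ev (qint p) == 0.
    by rewrite -evM /qint -subrX1 /ev rmorphB rmorphXn rmorph1 /= map_polyX
      !hornerE (prim_expr_order z_prim) subrr.
  rewrite mulf_eq0 evD evN ev1 evX subr_eq0 => /orP[/eqP z1|//].
  have := prim_order_dvd z_prim 1; rewrite z1 expr1 eqxx dvdn1 => /eqP p1.
  by have := p_prime; rewrite p1.
by rewrite -dvdp_size_eqp // szg szq.
Qed.

(** Write [qint p] = h g with g the gcd.  As g divides D, it does not vanish
    at z, so h does; then [qint p] divides h and g is constant. *)
Lemma coprimep_qint D : ev D != 0 -> coprimep D (qint p).
Proof.
move=> nzD; have /dvdpP[h eh] := dvdp_gcdr D (qint p).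
have /dvdpP[c ec] := dvdp_gcdl D (qint p).
set g := gcdp D _ in eh ec.
have nzg : ev g != 0 by apply: contra_neq nzD => g0; rewrite ec evM g0 mulr0.
have q0 : ev (qint p) == 0 by rewrite ev_qint_eq0.
have qnz : qint p != 0 by rewrite -size_poly_gt0 size_qint prime_gt0.
have hq : h %= qint p.
  have h0 : qint p %| h.
    by rewrite -ev_qint_eq0; move: q0; rewrite eh evM mulf_eq0 (negPf nzg) orbF.
  by rewrite /eqp h0 andbT eh dvdp_mulr.
have := congr1 (fun f : {poly rat} => size f) eh.
have hnz : h != 0 by apply: contra_neq qnz => h0; rewrite eh h0 mul0r.
have gnz : g != 0 by apply: contra_neq qnz => g0; rewrite eh g0 mulr0.
rewrite size_mul // -(eqp_size hq) /coprimep -/g.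
have := hnz; have := gnz; rewrite -!size_poly_gt0.
case: (size h) (size g) => [|i] [|j] //= _ _ /eqP.
by rewrite addnS eqSS -[X in X == _]addn0 eqn_add2l => /eqP <-.
Qed.

Lemma congr_of_specializes A B a :
  specializes A a -> specializes B a -> congr_qint p A B.
Proof.
move=> sA sB; split.
- by case: sA => N [D [nzD -> _]]; exists N, D; split=> //; apply: coprimep_qint.
- by case: sB => N [D [nzD -> _]]; exists N, D; split=> //; apply: coprimep_qint.
have := specializesD sA (specializesN sB); rewrite subrr => -[N [D [nzD e e0]]].
exists N, D; split=> //; last exact: coprimep_qint.
rewrite -ev_qint_eq0; move/esym/eqP: e0.
by rewrite mulf_eq0 invr_eq0 (negPf nzD) orbF.
Qed.
End PrimeOrder.
End Specialization.

(** * The residue of - r / m *)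

(** The fraction -r/m in lowest terms has a denominator that divides m, hence
    is nonzero modulo p; so the equation num * m = - r * den can be divided by
    it in F_p. *)
Lemma dvdn_least_residue p m r : prime p -> (0 < m)%N -> ~~ (p %| m)%N ->
  (p %| m * least_residue p (- (r%:R / m%:R)) + r)%N.
Proof.
move=> p_prime m_gt0 pm; rewrite /least_residue.
set x := - _; have pF := pchar_Fp p_prime.
have ex : numq x * m%:Z = - (r%:Z * denq x).
  apply/eqP; rewrite -(eqr_int rat) rmorphN !rmorphM /=.
  have dx : (denq x)%:~R != 0 :> rat by rewrite intr_eq0 denq_neq0.
  have -> : (numq x)%:~R = x * (denq x)%:~R by rewrite -{2}[x]divq_num_den divfK.
  rewrite mulrAC /x mulNr -[m%:~R]/(m%:R : rat) -[r%:~R]/(r%:R : rat).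
  by rewrite divfK ?pnatr_eq0 -?lt0n // mulNr.
have mF : m%:R != 0 :> 'F_p by rewrite -(dvdn_pcharf pF).
have eF : (numq x)%:~R * m%:R = - (r%:R * (denq x)%:~R) :> 'F_p.
  by have := congr1 (fun i : int => i%:~R : 'F_p) ex; rewrite rmorphN !rmorphM.
have dF : (denq x)%:~R != 0 :> 'F_p.
  have : (denq x %| m%:Z)%Z.
    rewrite -(@Gauss_dvdzr _ (numq x)).
      by rewrite ex rpredN; apply: dvdz_mull.
    by rewrite coprimez_sym; apply: coprime_num_den.
  case/dvdzP => c ec; apply: contra_neq mF => d0.
  by rewrite -[m%:R]/((m%:Z)%:~R) ec rmorphM /= d0 mulr0.
rewrite (dvdn_pcharf pF) natrD natrM.
have -> : (ratr x : 'F_p)%:R = ratr x :> 'F_p by apply: natr_Zp.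
by rewrite /ratr mulrCA mulrA eF mulNr mulfK // addNr.
Qed.

(** * The congruence *)

Lemma P_qlegendre n m r X :
  P n m r X = qlegendre (qq ^+ m) (qq ^+ r) (qq ^ (m%:Z - r%:Z)) n.+1 X.
Proof. by apply: eq_bigr => k _; rewrite exprM. Qed.

Theorem theorem3p6 (p m r : nat) (p_prime : prime p) (p_odd : odd p)
    (m_gt0 : (0 < m)%N) (r_gt0 : (0 < r)%N) (p_ndiv_m : ~~ (p %| m)%N) :
  congr_qint_poly p
    (P p.-1 m r 'X)
    ((-1) ^+ least_residue p (- (r%:R / m%:R)) *: P p.-1 m r (- 'X)).
Proof.
have p_gt0 := prime_gt0 p_prime.
have [z z_prim] := C_prim_root_exists p_gt0.
have nz : z != 0 by rewrite (prim_root_eq0 z_prim) -lt0n.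
have w_prim : p.-primitive_root (z ^+ m).
  by rewrite (prim_root_exp_coprime _ z_prim) coprime_sym prime_coprime.
have dvd_a := dvdn_least_residue r p_prime m_gt0 p_ndiv_m.
have lt_ap : (least_residue p (- (r%:R / m%:R)) < p)%N.
  by rewrite -[X in (_ < X)%N](Fp_cast p_prime) ltn_ord.
move: (least_residue _ _) dvd_a lt_ap => a dvd_a lt_ap.
have u_def : z ^+ r * (z ^+ m) ^+ a = 1.
  by rewrite -exprM -exprD addnC; apply/eqP; rewrite -(prim_order_dvd z_prim).
have v_def : z ^ (m%:Z - r%:Z) = (z ^+ m) ^+ a.+1.
  rewrite expfzDr // -exprnN -exprnP exprS; congr (_ * _).
  by apply: (mulfI (expf_neq0 r nz)); rewrite u_def divff // expf_neq0.
have one_neqN1 : 1 != -1 :> algC by rewrite -addr_eq0 -mulr2n pnatr_eq0.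
have sX : specializes z qq z by rewrite -{2}(evX z); apply: specializes_tofrac.
have sP X x : specializes_poly z X x -> specializes_poly z (P p.-1 m r X)
    (qlegendre (z ^+ m) (z ^+ r) ((z ^+ m) ^+ a.+1) p x).
  move=> sXx; rewrite P_qlegendre prednK // -v_def.
  apply: specializes_poly_qlegendre => //.
  - by move=> k; apply: prim_den_neq0.
  - exact: specializesX.
  - exact: specializesX.
  - exact: specializesXz.
move=> k; apply: (congr_of_specializes p_prime z_prim).
  by apply: sP; apply: specializes_polyX.
rewrite (qlegendre_prim_parity p_odd w_prim lt_ap one_neqN1 u_def).
apply: specializes_polyZ; last exact/sP/specializes_polyN/specializes_polyX.
exact/specializesX/specializesN/specializes1.
Qed.
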